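(* If $F=(f_1,\dots,f_k)^\top$ is feasible to the vector-valued superadditive dual (VSDP), then $Cx\leqq F(b)$ for all $x\in\mathcal{X}(b)$.
   Context: $x\leqq y$ for vectors means $y-x$ has all nonnegative components. $A\in\mathbb{R}^{m\times n}$ with columns $A_j$, $b\in\mathbb{R}^m$, $C=(c_{ij})\in\mathbb{R}^{k\times n}$; $\mathcal{X}(b)=\{x\in\mathbb{Z}^n\mid x\geqq 0,\ Ax\leqq b\}$ is the feasible region of the multiobjective integer program $\max\{Cx\mid x\in\mathcal{X}(b)\}$. The vector-valued superadditive dual (VSDP) is: minimize $F(b)=(f_1(b),\dots,f_k(b))^\top$ over $k$-tuples $F=(f_1,\dots,f_k)^\top$ of functions $f_i:\mathbb{R}^m\to\mathbb{R}$ such that $f_i(A_j)\ge c_{ij}$ for all $i=1,\dots,k$, $j=1,\dots,n$; $f_i(0)=0$ for all $i$; and each $f_i$ is nondecreasing ($\beta_1\leqq\beta_2\Rightarrow f_i(\beta_1)\le f_i(\beta_2)$) and superadditive ($f_i(\beta_1)+f_i(\beta_2)\le f_i(\beta_1+\beta_2)$). Such $F$ are called feasible to (VSDP). *)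

(* Defs.v *)
From mathcomp Require Import all_boot all_order all_algebra.
From mathcomp Require Import classical_sets reals.

Set Implicit Arguments.
Unset Strict Implicit.
Unset Printing Implicit Defensive.

Import Order.TTheory GRing.Theory Num.Theory.

Local Open Scope ring_scope.
Local Open Scope classical_set_scope.

Definition vecle (R : numDomainType) (d : nat) (x y : 'cV[R]_d) : Prop :=
  forall i, x i ord0 <= y i ord0.

Notation "x <=v y" := (vecle x y) (at level 70, no associativity) : ring_scope.

Definition intvec (R : pzRingType) (n : nat) (x : 'cV[int]_n) : 'cV[R]_n :=
  map_mx intr x.

Definition feasible_region (R : realType) (m n : nat) (A : 'M[R]_(m, n))
    (b : 'cV[R]_m) : set 'cV[int]_n :=
  [set x | 0 <=v x /\ A *m intvec R x <=v b].

Definition vnondecreasing (R : realType) (m : nat) (f : 'cV[R]_m -> R) : Prop :=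
  forall b1 b2, b1 <=v b2 -> f b1 <= f b2.

Definition superadditive (R : realType) (m : nat) (f : 'cV[R]_m -> R) : Prop :=
  forall b1 b2, f b1 + f b2 <= f (b1 + b2).

Definition vecfun (R : realType) (m k : nat) (F : 'I_k -> 'cV[R]_m -> R)
    (b : 'cV[R]_m) : 'cV[R]_k :=
  \col_i F i b.

Record VSDP_feasible (R : realType) (m n k : nat) (A : 'M[R]_(m, n))
    (C : 'M[R]_(k, n)) (F : 'I_k -> 'cV[R]_m -> R) : Prop := {
  VSDP_col : forall i j, C i j <= F i (col j A);
  VSDP_zero : forall i, F i 0 = 0;
  VSDP_nondecreasing : forall i, vnondecreasing (F i);
  VSDP_superadditive : forall i, superadditive (F i)
}.

(* Main.v *)
Require Import Defs.
From mathcomp Require Import all_boot all_order all_algebra.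
From mathcomp Require Import classical_sets reals.

(** Weak duality rests on reading [A x] as a sum of columns of [A], the [j]-th
one taken [x_j] times. This makes sense because [x] is integral and
nonnegative, and it is what lets superadditivity be iterated:
[(C x)_i = \sum_j x_j c_ij <= \sum_j x_j f_i(A_j) <= f_i(\sum_j x_j A_j)
         = f_i(A x) <= f_i(b)].
The first inequality is dual feasibility on the columns, the second is
[superadditive_mulrn] for each multiple followed by [superadditive_sum] over
the columns, and the last is monotonicity of [f_i]. *)

Import Order.TTheory GRing.Theory Num.Theory.

Local Open Scope ring_scope.
Local Open Scope classical_set_scope.

(** Normalisation at [0] is what covers the empty sum: superadditivity alone
only gives [f 0 <= 0]. *)
Lemma superadditive_sum (R : realType) (m : nat) (f : 'cV[R]_m -> R)
    (f0 : f 0 = 0) (fS : superadditive f) (I : Type) (r : seq I)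
    (v : I -> 'cV[R]_m) :
  \sum_(j <- r) f (v j) <= f (\sum_(j <- r) v j).
Proof.
elim/big_ind2: _ => [|s1 u1 s2 u2 le1 le2|//]; first by rewrite f0.
exact: le_trans (lerD le1 le2) (fS _ _).
Qed.

Lemma superadditive_mulrn (R : realType) (m : nat) (f : 'cV[R]_m -> R)
    (f0 : f 0 = 0) (fS : superadditive f) (v : 'cV[R]_m) (p : nat) :
  f v *+ p <= f (v *+ p).
Proof.
have := superadditive_sum R m f f0 fS 'I_p (index_enum 'I_p) (fun=> v).
by rewrite !sumr_const card_ord.
Qed.

Lemma mulmx_sum_col (R : comPzRingType) (m n : nat) (A : 'M[R]_(m, n))
    (u : 'cV[R]_n) :
  A *m u = \sum_j u j ord0 *: col j A.
Proof.
apply/colP => i; rewrite !mxE summxE; apply: eq_bigr => j _.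
by rewrite !mxE mulrC.
Qed.

Theorem proposition14 (R : realType) (m n k : nat)
    (A : 'M[R]_(m, n)) (b : 'cV[R]_m) (C : 'M[R]_(k, n))
    (F : 'I_k -> 'cV[R]_m -> R) (HF : VSDP_feasible A C F) :
  forall x : 'cV[int]_n, feasible_region A b x ->
    C *m intvec R x <=v vecfun F b.
Proof.
move=> x [x_ge0 Ax_le_b] i.
case: HF => F_col /(_ i) F0 /(_ i) F_mono /(_ i) F_super.
rewrite [leRHS]mxE; apply: le_trans (F_mono _ _ Ax_le_b).
rewrite mxE mulmx_sum_col.
apply: le_trans (superadditive_sum R m (F i) F0 F_super _ _ _).
apply: ler_sum => j _; rewrite mxE.
(* Nonnegativity leaves only the case of a natural number [p], so the scalar
   action becomes a [p]-fold repetition, to which superadditivity applies. *)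
have := x_ge0 j; rewrite mxE; case: (x j ord0) => // p _.
rewrite scaler_nat mulr_natr.
apply: le_trans (superadditive_mulrn R m (F i) F0 F_super _ p).
by rewrite lerMn2r F_col orbT.
Qed.
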